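(* Let $(x_n)_{n\ge 1}$ be a bounded sequence of real numbers and let $\ell\in\mathbf{R}$. Then $(x_n)$ is Cesàro convergent to $\ell$ if and only if, for every real number $\alpha>1$, $$\lim_{k\to\infty}\frac{1}{\alpha^{k+1}-\alpha^k}\sum_{\alpha^k\le i<\alpha^{k+1}}x_i=\ell,$$ where $k$ ranges over the nonnegative integers and the sum is over all integers $i$ with $\alpha^k\le i<\alpha^{k+1}$.
   Context: A real sequence $(x_n)_{n\ge 1}$ is Cesàro convergent to $\ell\in\mathbf{R}$ if $\lim_{n\to\infty}\frac{1}{n}\sum_{k=1}^n x_k=\ell$. An empty sum equals $0$. *)

(* Defs.v *)
From mathcomp Require Import all_boot all_order all_algebra.
From mathcomp Require Import all_classical all_reals all_analysis.

Set Implicit Arguments.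
Unset Strict Implicit.
Unset Printing Implicit Defensive.

Import Order.TTheory GRing.Theory Num.Theory.
Import numFieldNormedType.Exports.

Local Open Scope classical_set_scope.
Local Open Scope ring_scope.

(* A sequence (x_n)_{n >= 1} is a function x : nat -> R whose value at 0 is
   irrelevant: every notion below only involves the x n with n >= 1. *)

Definition bounded_seq (R : realType) (x : nat -> R) : Prop :=
  [bounded x n | n in [set n : nat | (1 <= n)%N]].

Definition cesaro_cvg (R : realType) (x : nat -> R) (l : R) : Prop :=
  (fun n : nat => n%:R^-1 * \sum_(1 <= k < n.+1) x k) @ \oo --> l.

(* The sum is a finitely supported sum over a set of naturals, which is finite
   when alpha > 1; 0 is then excluded since alpha ^+ k >= 1. *)
Definition geometric_block_mean (R : realType) (x : nat -> R) (alpha : R)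
    (k : nat) : R :=
  (alpha ^+ k.+1 - alpha ^+ k)^-1 *
  \sum_(i \in [set i : nat | alpha ^+ k <= i%:R < alpha ^+ k.+1]) x i.

(* Main.v *)
(** Put [S n = \sum_(1 <= i < n) x i] and
    [u k = S (ceil (alpha ^ k)) / alpha ^ k - l].  The block means converge to
    [l] iff [u] tends to [0]: the mean of block [k] is
    [l + (alpha * u k.+1 - u k) / (alpha - 1)], and this relation, read as a
    recursion for [u], contracts by the factor [1 / alpha].  If [x] is Cesàro
    convergent then [u] tends to [0] as [ceil (alpha ^ k)] is equivalent to
    [alpha ^ k].  Conversely, for [alpha ^ k <= n < alpha ^ k.+1], boundedness
    makes [|S n / n - l|] at most [|u k| + O(alpha - 1)], uniformly in [n];
    let [n] go to infinity and then [alpha] to [1]. *)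
Require Import Defs.
From mathcomp Require Import all_boot all_order all_algebra.
From mathcomp Require Import all_classical all_reals all_analysis.
From mathcomp Require Import ring lra.

Set Implicit Arguments.
Unset Strict Implicit.
Unset Printing Implicit Defensive.

Import Order.TTheory GRing.Theory Num.Theory.
Import numFieldNormedType.Exports.

Local Open Scope classical_set_scope.
Local Open Scope ring_scope.

(** For [0 <= t] the ceiling is already nonnegative, so the absolute value only moves it to
    [nat]. *)
Definition natceil (R : realType) (t : R) : nat := `|Num.ceil t|%N.

Lemma natceil_le (R : realType) (t : R) (n : nat) :
  0 <= t -> (natceil t <= n)%N = (t <= n%:R).
Proof.
move=> t0; have c0 : 0 <= Num.ceil t by rewrite ceil_ge0; lra.
by rewrite /natceil -lez_nat gez0_abs// ceil_le_int.
Qed.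

Lemma natceil_ge (R : realType) (t : R) : 0 <= t -> t <= (natceil t)%:R.
Proof. by move=> t0; rewrite -natceil_le. Qed.

Lemma natceil_gt0 (R : realType) (t : R) : 0 < t -> (0 < natceil t)%N.
Proof. by move=> t0; rewrite ltnNge (natceil_le _ (ltW t0)) -ltNge. Qed.

Lemma natceil_pred_lt (R : realType) (t : R) :
  0 < t -> (natceil t).-1%:R < t.
Proof.
move=> t0; rewrite ltNge -(natceil_le _ (ltW t0)) -ltnNge.
by rewrite prednK// natceil_gt0.
Qed.

Lemma cvg_exprV (R : realType) (a : R) :
  1 < a -> (fun k : nat => (a ^+ k)^-1) @ \oo --> 0.
Proof.
move=> a1; have -> : (fun k : nat => (a ^+ k)^-1) = GRing.exp a^-1.
  by apply/funext => k; rewrite exprVn.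
apply: cvg_expr; rewrite ger0_norm ?invr_ge0; last lra.
by rewrite invf_lt1//; lra.
Qed.

Lemma near_expr_ge (R : realType) (a A : R) :
  1 < a -> \forall k \near \oo, A <= a ^+ k.
Proof.
move=> a1; have B0 : 0 < `|A| + 1 by have := normr_ge0 A; lra.
have /cvgrPdist_le /(_ (`|A| + 1)^-1) := cvg_exprV a1.
rewrite invr_gt0 => /(_ B0); apply: filterS => k.
have ak0 : 0 < a ^+ k by apply: exprn_gt0; lra.
rewrite sub0r normrN gtr0_norm ?invr_gt0// lef_pV2 ?posrE// => h.
by have := ler_norm A; lra.
Qed.

Lemma geometric_bracket (R : realType) (a : R) (n : nat) :
  1 < a -> (0 < n)%N -> exists k, a ^+ k <= n%:R < a ^+ k.+1.
Proof.
move=> a1 n0.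
have ex : exists k, n%:R < a ^+ k.
  have [k _ /(_ k (leqnn k)) /= h] := near_expr_ge (n%:R + 1) a1.
  by exists k; lra.
(* The least exponent [j] with [n%:R < a ^+ j] is nonzero because [1 <= n]; its predecessor is the
   index sought. *)
case: (ex_minnP ex) => -[|k] h hmin.
  by move: h; rewrite expr0 -[1]/(1%:R) ltr_nat ltnS leqNgt n0.
by exists k; rewrite h andbT leNgt; apply/negP => /hmin; rewrite ltnn.
Qed.

Definition partial_sum (R : realType) (x : nat -> R) (n : nat) : R :=
  \sum_(1 <= i < n) x i.

(** Since [i] is an integer, both bounds on it may be replaced by their ceilings, which turns the
    block into an integer interval. *)
Lemma geometric_block_meanE (R : realType) (x : nat -> R) (a : R) (k : nat) :
  1 < a -> geometric_block_mean x a k = (a ^+ k.+1 - a ^+ k)^-1 *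
    (partial_sum x (natceil (a ^+ k.+1)) - partial_sum x (natceil (a ^+ k))).
Proof.
move=> a1; have ak0 j : 0 < a ^+ j by apply: exprn_gt0; lra.
rewrite /geometric_block_mean; congr (_ * _).
have natceilE j n : (natceil (a ^+ j) <= n)%N = (a ^+ j <= n%:R).
  by rewrite natceil_le// ltW.
set c := natceil (a ^+ k); set c' := natceil (a ^+ k.+1).
have cc' : (c <= c')%N.
  rewrite natceilE; apply: le_trans (natceil_ge (ltW (ak0 k.+1))).
  by rewrite exprS ler_peMl// ltW.
have -> : [set i : nat | a ^+ k <= i%:R < a ^+ k.+1] = [set` index_iota c c'].
  apply/seteqP; split => i /=;
    by rewrite mem_index_iota natceilE ltnNge natceilE -ltNge.
rewrite -fsbig_seq ?iota_uniq// /partial_sum.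
rewrite [X in _ = X - _](big_cat_nat _ (n := c))//=.
- by rewrite addrC addrK.
- by rewrite natceil_gt0.
Qed.

(** Dividing by [a ^+ k], not by the number of terms, makes the relation to the block means
    exact. *)
Definition scaled_error (R : realType) (x : nat -> R) (l a : R) (k : nat) : R :=
  partial_sum x (natceil (a ^+ k)) / a ^+ k - l.

Lemma geometric_block_mean_error (R : realType) (x : nat -> R) (l a : R)
    (k : nat) :
  1 < a -> geometric_block_mean x a k =
  l + (a - 1)^-1 * (a * scaled_error x l a k.+1 - scaled_error x l a k).
Proof.
move=> a1; have ak0 : 0 < a ^+ k by apply: exprn_gt0; lra.
rewrite geometric_block_meanE// /scaled_error exprS.
field; rewrite !gt_eqF//; try lra.
by rewrite -{2}[a ^+ k]mul1r -mulrBl mulr_gt0//; lra.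
Qed.

Lemma cesaro_scaled_error (R : realType) (x : nat -> R) (l a : R) :
  1 < a -> cesaro_cvg x l -> scaled_error x l a @ \oo --> 0.
Proof.
move=> a1 xl; have ak0 j : 0 < a ^+ j by apply: exprn_gt0; lra.
(* [d k] is the number of terms in [partial_sum x (natceil (a ^+ k))], whose upper bound is
   excluded. *)
pose d k := (natceil (a ^+ k)).-1.
have dlt k : (d k)%:R < a ^+ k by exact: natceil_pred_lt.
have dge k : a ^+ k <= (d k)%:R + 1.
  by rewrite natr1 prednK ?natceil_gt0// natceil_ge// ltW.
have d_oo : d @ \oo --> \oo.
  apply/cvgnyPge => A; apply: filterS (near_expr_ge (A%:R + 1) a1) => k h.
  by rewrite -(ler_nat R); have := dge k; lra.
have ratio : (fun k => (d k)%:R / a ^+ k) @ \oo --> (1 : R).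
  apply: (@squeeze_cvgr _ _ _ _ (fun k => 1 - (a ^+ k)^-1) (fun=> 1)).
  - near=> k; rewrite ler_pdivrMr// mul1r (ltW (dlt k)) andbT.
    by rewrite ler_pdivlMr// mulrBl mulVf ?gt_eqF// mul1r; have := dge k; lra.
  - rewrite -[X in _ --> X]subr0; apply: cvgB; first exact: cvg_cst.
    exact: cvg_exprV.
  - exact: cvg_cst.
have -> : scaled_error x l a = fun k =>
    ((d k)%:R^-1 * \sum_(1 <= i < (d k).+1) x i) * ((d k)%:R / a ^+ k) - l.
  apply/funext => k; rewrite /scaled_error; congr (_ - l).
  have -> : natceil (a ^+ k) = (d k).+1 by rewrite prednK// natceil_gt0.
  (* [d 0 = 0]: the sum is then empty and both sides vanish. *)
  case: (d k) => [|m]; first by rewrite /partial_sum big_geq// !mul0r mulr0.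
  have : m.+1%:R != 0 :> R by rewrite pnatr_eq0.
  by rewrite /partial_sum; move: m.+1%:R => D D0; field; rewrite D0 gt_eqF.
rewrite -[X in _ --> X](subrr l); apply: cvgB; last exact: cvg_cst.
rewrite -[X in _ --> X]mulr1; apply: cvgM ratio.
exact: (cvg_comp d _ d_oo xl).
Unshelve. all: by end_near.
Qed.

Lemma dist_partial_sums (R : realType) (x : nat -> R) (M : R) (m n : nat) :
  (forall i, (1 <= i)%N -> `|x i| <= M) -> (1 <= m <= n)%N ->
  `|partial_sum x n - partial_sum x m| <= M * (n%:R - m%:R).
Proof.
move=> xM /andP[m1 mn].
rewrite /partial_sum (big_cat_nat _ (n := m))//= addrAC subrr add0r.
apply: le_trans (ler_norm_sum _ _ _) _.
apply: (@le_trans _ _ (\sum_(m <= i < n) M)).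
  by apply: ler_sum_nat => i /andP[mi _]; apply: xM; apply: leq_trans mi.
by rewrite sumr_const_nat -natrB// mulr_natr.
Qed.

Lemma cesaro_mean_error (R : realType) (x : nat -> R) (l a M : R) (k n : nat) :
  1 < a -> (forall i, (1 <= i)%N -> `|x i| <= M) ->
  a ^+ k <= n%:R < a ^+ k.+1 ->
  `|partial_sum x n / n%:R - l| <=
    `|scaled_error x l a k| + (M + `|l|) * (a - 1).
Proof.
move=> a1 xM /andP[akn nak]; have ak0 : 0 < a ^+ k by apply: exprn_gt0; lra.
have M0 : 0 <= M by apply: le_trans (xM 1%N isT).
have n0 : 0 < n%:R :> R by lra.
set c := natceil (a ^+ k).
have SnSc : `|partial_sum x n - partial_sum x c| <= M * (n%:R - c%:R).
  by apply: dist_partial_sums => //;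
    rewrite natceil_gt0//= (natceil_le _ (ltW ak0)).
have ca : a ^+ k <= c%:R by rewrite natceil_ge// ltW.
have -> : partial_sum x n / n%:R - l = n%:R^-1 *
    ((partial_sum x n - partial_sum x c) +
     (a ^+ k * scaled_error x l a k - l * (n%:R - a ^+ k))).
  by rewrite /scaled_error -/c; field; rewrite !gt_eqF.
rewrite normrM gtr0_norm ?invr_gt0// mulrC ler_pdivrMr//.
apply: le_trans (ler_normD _ _) _.
have := ler_normB (a ^+ k * scaled_error x l a k) (l * (n%:R - a ^+ k)).
rewrite !normrM (ger0_norm (ltW ak0)) (@ger0_norm _ (n%:R - _)) ?subr_ge0//.
move: nak; rewrite exprS => nak.
have := normr_ge0 l; have := normr_ge0 (scaled_error x l a k).
move: `|scaled_error x l a k| `|l| SnSc => e L SnSc e0 L0 h.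
have h1 : a ^+ k * e <= n%:R * e by rewrite ler_wpM2r.
(* [n < a * a ^+ k] gives [n - a ^+ k < (a - 1) * a ^+ k], and [a ^+ k <= n]. *)
have h2 : n%:R - a ^+ k <= (a - 1) * n%:R by nra.
have h3 : M * (n%:R - c%:R) <= M * ((a - 1) * n%:R) by rewrite ler_wpM2l//; lra.
have h4 : L * (n%:R - a ^+ k) <= L * ((a - 1) * n%:R) by rewrite ler_wpM2l.
by lra.
Qed.

(** [u k.+1] is a convex combination of [u k] and [b k] with weights [1 / a] and [1 - 1 / a]. Once
    [b] stays within [e / 2], so does [u] up to an excess that shrinks by [1 / a] at each step. *)
Lemma cvg0_contraction (R : realType) (a : R) (u b : nat -> R) :
  1 < a -> (forall k, a * u k.+1 = u k + (a - 1) * b k) ->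
  b @ \oo --> 0 -> u @ \oo --> 0.
Proof.
move=> a1 ub /cvgrPdist_le b0; apply/cvgrPdist_le => e e0.
have e20 : 0 < e / 2 by lra.
have [N _ bN] := b0 _ e20.
have ak0 j : 0 < a ^+ j by apply: exprn_gt0; lra.
have bound j : `|u (N + j)%N| <= e / 2 + `|u N| / a ^+ j.
  elim: j => [|j IH]; first by rewrite addn0 expr0 divr1; lra.
  have := bN (N + j)%N (leq_addr _ _); rewrite /= sub0r normrN => bj.
  have a0 : 0 < a by lra.
  rewrite addnS -(ler_pM2l a0).
  have -> : a * (e / 2 + `|u N| / a ^+ j.+1) = a * (e / 2) + `|u N| / a ^+ j.
    by rewrite exprS; field; rewrite !gt_eqF.
  rewrite -{1}(gtr0_norm a0) -normrM ub.
  apply: le_trans (ler_normD _ _) _.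
  rewrite normrM (@ger0_norm _ (a - 1)); last lra.
  have : (a - 1) * `|b (N + j)%N| <= (a - 1) * (e / 2).
    by rewrite ler_wpM2l//; lra.
  by lra.
(* After [K] further steps the excess [|u N| / a ^+ j] is at most [e / 2]. *)
have [K _ aK] := near_expr_ge (`|u N| / (e / 2)) a1.
exists (N + K)%N => // n /= NKn; rewrite sub0r normrN.
have Nn : (N <= n)%N by apply: leq_trans NKn; rewrite leq_addr.
have := aK (n - N)%N; rewrite /= leq_subRL// => /(_ NKn).
rewrite ler_pdivrMr// mulrC -ler_pdivrMr// => h.
by have := bound (n - N)%N; rewrite subnKC//; lra.
Qed.

Theorem theorem1p1 (R : realType) (x : nat -> R) (l : R)
    (x_bounded : bounded_seq x) :
  cesaro_cvg x l <->
  (forall alpha : R, 1 < alpha -> geometric_block_mean x alpha @ \oo --> l).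
Proof.
split=> [xl a a1|xl].
  rewrite (_ : geometric_block_mean x a = fun k => l +
      (a - 1)^-1 *
      (a * scaled_error x l a k.+1 - scaled_error x l a k)); last first.
    by apply/funext => k; exact: geometric_block_mean_error.
  have u0 := cesaro_scaled_error a1 xl.
  have u0S : (fun k => scaled_error x l a k.+1) @ \oo --> 0.
    by rewrite (cvg_shiftS (scaled_error x l a)).
  rewrite -[X in _ --> X]addr0 -[X in _ --> _ + X](mulr0 (a - 1)^-1).
  apply: cvgD; first exact: cvg_cst.
  apply: cvgM; first exact: cvg_cst.
  rewrite -[X in _ --> X](subrr 0) -[X in _ --> X - _](mulr0 a).
  by apply: cvgB => //; apply: cvgM => //; exact: cvg_cst.
have [M M0 xM] := pinfty_ex_gt0 x_bounded.
have {}xM i : (1 <= i)%N -> `|x i| <= M by exact: xM.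
apply/cvgrPdist_le => e e0; have e30 : 0 < e / 3 by lra.
pose B := M + `|l|.
have B0 : 0 < B by have := normr_ge0 l; rewrite /B; lra.
(* Chosen so that the term [B * (a - 1)] of [cesaro_mean_error] equals [e / 3]. *)
pose a := 1 + e / 3 / B.
have a1 : 1 < a by rewrite ltrDl divr_gt0.
have u0 : scaled_error x l a @ \oo --> 0.
  apply: (@cvg0_contraction _ a _
    (fun k => geometric_block_mean x a k - l)) => //.
    move=> k; rewrite (geometric_block_mean_error x l k a1).
    by field; rewrite gt_eqF//; lra.
  by rewrite -[X in _ --> X](subrr l); apply: cvgB (xl a a1) (cvg_cst _).
have /cvgrPdist_le /(_ _ e30) [K _ uK] := u0.
near=> n.
have n1 : (1 <= n)%N by near: n; exact: nbhs_infty_ge.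
have n0 : 0 < n%:R :> R by rewrite ltr0n.
have [k kn] := geometric_bracket a1 n1.
have Kk : (K <= k)%N.
  have aKn : a ^+ K <= n%:R by near: n; exact: nbhs_infty_ger.
  rewrite -ltnS -(ltr_eXn2l a1); apply: le_lt_trans aKn _.
  by case/andP: kn.
have := uK k Kk; rewrite /= sub0r normrN => uk.
have err := cesaro_mean_error l a1 xM kn.
(* The Cesàro mean includes [x n], which [partial_sum x n] omits; this last term takes the remaining
   third of [e]. *)
have xn : `|n%:R^-1 * x n| <= e / 3.
  have Mn : M / (e / 3) <= n%:R by near: n; exact: nbhs_infty_ger.
  rewrite normrM gtr0_norm ?invr_gt0// mulrC ler_pdivrMr//.
  by apply: le_trans (xM n n1) _; rewrite mulrC -ler_pdivrMr.
have Ba : (M + `|l|) * (a - 1) = e / 3.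
  by rewrite -/B /a; field; rewrite gt_eqF.
rewrite distrC big_nat_recr//= mulrDr addrAC [n%:R^-1 * _]mulrC.
by apply: le_trans (ler_normD _ _) _; lra.
Unshelve. all: by end_near.
Qed.
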